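(* Let $X=(X(t))_{t\in\mathbb{R}}$ be the positive supOU process with characteristics $\pi$ and $\lambda$ (as defined in the context). Assume that $\int_{(0,1]} z\,\lambda(\mathrm{d}z)<\infty$, $m_0(\pi)=\pi((0,\infty))<\infty$, and $\inf\{y>0:\overline{\lambda}(y)=0\}<\infty$ (i.e. $\lambda$ has bounded support). Then $$0<\limsup_{t\to\infty}\frac{\log\log t}{\log t}\,X(t)<\infty\quad\text{almost surely.}$$
   Context: For a measure $Q$ on $(0,\infty)$ write $m_p(Q)=\int_{(0,\infty)}x^p\,Q(\mathrm{d}x)$ and $\overline{Q}(x)=Q((x,\infty))$ for $x>0$. Setting: $\pi$ is a nonzero measure on $(0,\infty)$ with $m_{-1}(\pi)=\int_{(0,\infty)}x^{-1}\pi(\mathrm{d}x)<\infty$. $\lambda$ is a nonzero Lévy measure on $(0,\infty)$, i.e. $\int_{(0,\infty)}(1\wedge z^2)\lambda(\mathrm{d}z)<\infty$, satisfying $\int_{(1,\infty)}\log z\,\lambda(\mathrm{d}z)<\infty$. $\mu$ is a Poisson random measure on $(0,\infty)\times\mathbb{R}\times(0,\infty)$ with intensity measure $\nu(\mathrm{d}x,\mathrm{d}s,\mathrm{d}z)=\pi(\mathrm{d}x)\,\mathrm{d}s\,\lambda(\mathrm{d}z)$, with points $(\xi_k,\tau_k,\zeta_k)_{k\ge 0}$. When $\int_{(0,1]}z\,\lambda(\mathrm{d}z)<\infty$, the positive supOU process (drift chosen so that there is no centering) is $$X(t)=\sum_{k:\tau_k\le t}e^{-\xi_k(t-\tau_k)}\zeta_k,\qquad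 t\in\mathbb{R}.$$ *)

(* Defs.v *)
From HB Require Import structures.
From mathcomp Require Export all_boot all_order all_algebra.
From mathcomp Require Export all_classical all_reals all_analysis.
From mathcomp Require Export measurable_realfun.
Export Order.TTheory GRing.Theory Num.Theory.
Export numFieldNormedType.Exports.

Set Implicit Arguments.
Unset Strict Implicit.
Unset Printing Implicit Defensive.

#[global] Open Scope classical_set_scope.
#[global] Open Scope ring_scope.

(* A measure on (0, +oo) is represented by a Borel measure on R which does not
   charge ]-oo, 0]. *)
Definition concentrated_on_pos (R : realType)
    (Q : {measure set (measurableTypeR R) -> \bar R}) : Prop :=
  Q `]-oo, 0]%classic = 0%E.

Definition moment (R : realType) (p : R)
    (Q : {measure set (measurableTypeR R) -> \bar R}) : \bar R :=
  (\int[Q]_(x in `]0%R, +oo[) (x `^ p)%:E)%E.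

Definition tail (R : realType)
    (Q : {measure set (measurableTypeR R) -> \bar R}) (y : R) : \bar R :=
  Q `]y, +oo[%classic.

Definition Levy_measure (R : realType)
    (Q : {measure set (measurableTypeR R) -> \bar R}) : Prop :=
  concentrated_on_pos Q /\
  (\int[Q]_(z in `]0%R, +oo[) (Num.min 1 (z ^+ 2))%:E < +oo)%E.

Definition mutually_independent d d' (Omega : measurableType d)
    (T : measurableType d') (R : realType) (P : probability Omega R)
    (I : finType) (X : I -> Omega -> T) : Prop :=
  forall A : I -> set T, (forall i, measurable (A i)) ->
    P [set w | forall i, A i (X i w)] =
    (\prod_(i : I) P (X i @^-1` A i))%E.

(* In [poisson_prob r k], the Poisson distribution of mean [r] (the Dirac mass
   at 0 if [r = 0]), the argument [k] is a dummy. *)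
Record Poisson_random_measure d d' (Omega : measurableType d)
    (E : measurableType d') (R : realType) (P : probability Omega R)
    (nu : set E -> \bar R) (M : Omega -> {measure set E -> \bar R}) : Prop := {
  prm_measurable : forall B : set E, measurable B ->
    measurable_fun [set: Omega] (M ^~ B) ;
  prm_poisson : forall B : set E, measurable B -> (nu B < +oo)%E ->
    forall k : nat,
      P [set w | M w B = (k%:R)%:E] = poisson_prob (fine (nu B)) 0%N [set k] ;
  prm_infinite : forall B : set E, measurable B -> nu B = +oo%E ->
    P [set w | M w B = +oo%E] = 1%E ;
  prm_independent : forall (n : nat) (B : 'I_n -> set E),
    (forall i, measurable (B i)) -> trivIset [set: 'I_n] B ->
    mutually_independent P (fun (i : 'I_n) w => M w (B i)) }.

(* The measure pi(dx) ds lambda(dz). *)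
Definition supOU_intensity (R : realType)
    (Pi Lambda : {measure set (measurableTypeR R) -> \bar R}) :
    set (measurableTypeR R * measurableTypeR R * measurableTypeR R) -> \bar R :=
  ((Pi \x (@lebesgue_measure R)) \x Lambda)%E.

(* The random measure with an atom of mass 1 at each point
   (xi k, tau k, zeta k); points may coincide. *)
Definition point_measure d (Omega : measurableType d) (R : realType)
    (xi tau zeta : nat -> Omega -> measurableTypeR R) (w : Omega) :
    {measure set (measurableTypeR R * measurableTypeR R * measurableTypeR R)
       -> \bar R} :=
  mseries (fun k => \d_(xi k w, tau k w, zeta k w)) 0.

Definition supOU d (Omega : measurableType d) (R : realType)
    (xi tau zeta : nat -> Omega -> R) (t : R) (w : Omega) : \bar R :=
  (\sum_(0 <= k <oo | (tau k w <= t)%R)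
      (expR (- xi k w * (t - tau k w)) * zeta k w)%:E)%E.

(* Main.v *)
Require Import Defs.
From mathcomp Require Import ring lra.

Set Implicit Arguments.
Unset Strict Implicit.
Unset Printing Implicit Defensive.

(** The growth rate ln t / ln (ln t) is that of the maximum of t independent
    Poisson variables: a Poisson variable takes the value k with probability
    k^(-k (1 + o(1))), so among t of them values up to about ln t / ln (ln t)
    occur, and none of a larger order.

    Lower bound.  Choose a box of points with xi <= b + 1 and zeta > 1/(j+1)
    whose intensity c per unit of time is positive and finite.  At time n + 1
    the process is at least kappa = exp(-(b+1)) / (j+1) times the number N_n of
    such points with tau in (n, n+1] ([supOU_ge_box]).  The N_n are independent
    and Poisson(c).  Among the k^(2k) indices n in [k^(2k), 2 k^(2k)), the value
    k is missed with probability at most exp(-exp(-c) k) for large k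
    ([miss_prob_le], [poisson_weight_block_ge]), which tends to 0; hence almost
    surely N_n = k for some such n, for infinitely many k
    ([negligible_rarely]).  At these times ln (ln t) / ln t >= 1 / (3 k)
    ([rate_block_ge]), so the limsup is at least kappa / 3.

    Upper bound.  For t in [T, T+1], X(t) is at most the Poisson integral of
    f(x, s, z) = exp(-x (T-s)^+) z.  Cut the state space into countably many
    rectangular cells on which 1/x, T - s and 1/z vary by at most 1, and
    dominate f by a step function that is constant on the cells
    ([supOU_kernel_le_weight]).  Its values are at most 2 K, where K >= 1 bounds
    the jumps, and its integral against the intensity is at most a number D of
    the order of (m_{-1}(pi) + m_0(pi)) * int min(1, z) lambda(dz), uniformly in
    T ([cell_total_bounded]).  The counts of distinct cells are independent
    Poisson variables, so the exponential Markov inequality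
    ([poisson_chernoff]) bounds the probability that the process exceeds c on
    [T, T+1] by exp(D s exp(2 K s) - s c) ([exceed_prob_le]).  With T = n,
    s = ln (ln n) / (4 K) and c = (2 D + 8 K) ln n / ln (ln n), this is at most
    n^(-2) ([chernoff_exponent_le]), and the Borel-Cantelli lemma concludes
    ([supOU_rate_bounded]).

    Both halves only use the counts of the point process in rectangles. *)

Local Notation state R :=
  (measurableTypeR R * measurableTypeR R * measurableTypeR R)%type.

(** * Counts of a Poisson random measure *)

Lemma series_exp_coeff_le (R : realType) (x : R) n :
  0 <= x -> series (exp_coeff x) n <= expR x.
Proof.
move=> x0; apply: nondecreasing_cvgn_le; last exact: is_cvg_series_exp_coeff.
by apply: nondecreasing_series => k _ _; exact: exp_coeff_ge0.
Qed.

Definition poisson_weight (R : realType) (r : R) (k : nat) : R :=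
  r ^+ k / k`!%:R * expR (- r).

Lemma poisson_weight_ge0 (R : realType) (r : R) k :
  0 <= r -> 0 <= poisson_weight r k.
Proof.
by move=> r0; rewrite mulr_ge0 ?expR_ge0// divr_ge0// exprn_ge0.
Qed.

Lemma poisson_weight_series (R : realType) (r : R) n :
  \sum_(k < n) poisson_weight r k = series (exp_coeff r) n * expR (- r).
Proof. by rewrite /series /= big_mkord mulr_suml. Qed.

(** The generating function of the Poisson distribution of mean r at q is
    exp (r (q - 1)); it dominates its truncations, the only form in which it is
    used. *)
Lemma poisson_laplace_le (R : realType) (r q : R) n : 0 <= r -> 0 <= q ->
  \sum_(k < n) poisson_weight r k * q ^+ k <= expR (r * (q - 1)).
Proof.
move=> r0 q0.
have -> : r * (q - 1) = r * q + - r by ring.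
rewrite expRD -ler_pdivrMr ?expR_gt0//.
apply: le_trans (series_exp_coeff_le n (mulr_ge0 r0 q0)).
rewrite ler_pdivrMr ?expR_gt0// /series /= big_mkord mulr_suml.
apply: ler_sum => k _; rewrite /poisson_weight /exp_coeff /= exprMn.
by rewrite le_eqVlt; apply/orP; left; apply/eqP; ring.
Qed.

Lemma poisson_weight_total (R : realType) (r : R) :
  (1 - \sum_(k < n) poisson_weight r k) @[n --> \oo] --> (0 : R).
Proof.
under eq_fun do rewrite poisson_weight_series.
rewrite -(subrr 1) -{2}(expRxMexpNx_1 r).
apply: cvgB; first exact: cvg_cst.
by apply: cvgMl; exact: is_cvg_series_exp_coeff.
Qed.

Lemma probability_fin_bigcup_le (d : measure_display) (T : measurableType d)
    (R : realType) (P : probability T R) (I : finType)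
    (Q : pred I) (F : I -> set T) : (forall i, measurable (F i)) ->
  (P (\bigcup_(i in [set` Q]) F i) <= \sum_(i in Q) P (F i))%E.
Proof.
move=> mF; rewrite bigcup_pred; elim: (index_enum I) => [|i s IH].
  by rewrite !big_nil measure0.
rewrite !big_cons; case: ifPn => // Qi.
apply: le_trans (measureU2 P _ _) _ => //; last exact: leeD.
exact: bigsetU_measurable.
Qed.

Section counts.
Context d d' (Omega : measurableType d) (E : measurableType d') (R : realType).
Variables (P : probability Omega R) (nu : set E -> \bar R).
Variable M : Omega -> {measure set E -> \bar R}.
Hypothesis prmM : Poisson_random_measure P nu M.

Lemma measurable_count (B : set E) (x : \bar R) : measurable B ->
  measurable [set w | M w B = x].
Proof.
move=> mB; rewrite (_ : mkset _ = [set: Omega] `&` (M ^~ B) @^-1` [set x]).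
  by apply: (prm_measurable prmM mB) => //; exact: emeasurable_set1.
by rewrite setTI.
Qed.

(** For r = 0 the convention 0 ^+ 0 = 1 makes [poisson_weight] the Dirac mass
    at 0, so that cells of zero intensity are covered. *)
Lemma count_prob (B : set E) (r : R) k : measurable B -> 0 <= r ->
  nu B = r%:E -> P [set w | M w B = k%:R%:E] = (poisson_weight r k)%:E.
Proof.
move=> mB r0 nuB; rewrite (prm_poisson prmM)// ?nuB ?ltry//=.
rewrite /poisson_prob; case: ifPn => rp.
  by rewrite esum_set1 /poisson_pmf ?rp// lee_fin poisson_weight_ge0.
have -> : r = 0 by apply/eqP; rewrite eq_le r0 andbT leNgt.
rewrite /poisson_weight oppr0 expR0 mulr1 diracE expr0n.
case: k => [|k]; last by rewrite mul0r memNset.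
by rewrite mem_set// divr1.
Qed.

Lemma count_null (B : set E) : measurable B -> nu B = 0%E ->
  P.-negligible [set w | M w B <> 0%E].
Proof.
move=> mB nuB; apply/negligibleP.
  by apply: measurableC; exact: measurable_count.
rewrite -[LHS]/(P (~` [set w | M w B = 0%:R%:E])).
rewrite probability_setC; last exact: measurable_count.
rewrite (@count_prob _ 0)// /poisson_weight oppr0 expR0 mulr1 expr0 divr1.
by rewrite subee.
Qed.

(** Independence transported from families indexed by ordinals to families
    indexed by any finite type, such as a cube of cells. *)
Lemma counts_independent (I : finType) (B : I -> set E) (A : I -> set (\bar R)) :
  (forall i, measurable (B i)) -> trivIset [set: I] B ->
  (forall i, measurable (A i)) ->
  P [set w | forall i, A i (M w (B i))] =
  (\prod_i P [set w | A i (M w (B i))])%E.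
Proof.
move=> mB tB mA.
have tB' : trivIset [set: 'I_#|I|] (fun i => B (enum_val i)).
  by move=> i j _ _ /(tB _ _ Logic.I Logic.I); exact: enum_val_inj.
have H := prm_independent prmM (fun i : 'I_#|I| => mB (enum_val i)) tB'
  (fun i => mA (enum_val i)).
rewrite (big_enum_val (fun i => P [set w | A i (M w (B i))])) -[RHS]H.
congr (P _).
apply/seteqP; split => w /= h i //.
by have := h (enum_rank i); rewrite enum_rankK.
Qed.

Lemma joint_count_prob (I : finType) (B : I -> set E) (r : I -> R)
    (f : I -> nat) :
  (forall i, measurable (B i)) -> trivIset [set: I] B ->
  (forall i, 0 <= r i) -> (forall i, nu (B i) = (r i)%:E) ->
  P [set w | forall i, M w (B i) = (f i)%:R%:E] =
  (\prod_i poisson_weight (r i) (f i))%:E.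
Proof.
move=> mB tB r0 nuB.
rewrite (@counts_independent _ B (fun i => [set (f i)%:R%:E]))//.
by rewrite -prodEFin; apply: eq_bigr => i _; apply: count_prob.
Qed.

Let overflow L (B : set E) := ~` \bigcup_(k < L) [set w | M w B = k%:R%:E].

Let measurable_overflow L B : measurable B -> measurable (overflow L B).
Proof.
move=> mB; apply: measurableC; apply: bigcup_measurable => k _.
exact: measurable_count.
Qed.

Let overflow_prob L (B : set E) (r : R) : measurable B -> 0 <= r ->
  nu B = r%:E -> P (overflow L B) = (1 - \sum_(k < L) poisson_weight r k)%:E.
Proof.
move=> mB r0 nuB; rewrite probability_setC; last first.
  by apply: bigcup_measurable => k _; exact: measurable_count.
rewrite bigcup_mkord measure_bigsetU_ord; last 2 first.
- by move=> k; exact: measurable_count.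
- move=> i j _ _ [w [/= -> []]] /eqP; rewrite eqr_nat => /eqP ij.
  exact: val_inj.
rewrite EFinB -sumEFin; congr (_ - _)%E; apply: eq_bigr => k _.
exact: count_prob.
Qed.

(** The exponential Markov inequality for a sum of weighted independent
    Poisson counts.  Truncating the counts below L turns the expectation of the
    exponential into a finite sum over functions, which factors as a product;
    the truncation error vanishes as L tends to infinity. *)
Lemma poisson_chernoff (I : finType) (B : I -> set E) (r a : I -> R) (s c : R) :
  (forall i, measurable (B i)) -> trivIset [set: I] B ->
  (forall i, 0 <= r i) -> (forall i, nu (B i) = (r i)%:E) ->
  0 <= s ->
  (P [set w | (c%:E < \sum_i (a i)%:E * M w (B i))%E] <=
   (expR (\sum_i r i * (expR (s * a i) - 1) - s * c))%:E)%E.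
Proof.
move=> mB tB r0 nuB s0; set S := [set w | _].
have mS : measurable S.
  rewrite -[S]setTI; apply: emeasurable_fun_o_infty => //.
  apply: emeasurable_sum => i; apply: emeasurable_funM => //.
  exact: (prm_measurable prmM).
(* It suffices to bound P S with the counts truncated below L. *)
have trunc L : (P S <= (\sum_i (1 - \sum_(k < L) poisson_weight (r i) k) +
    expR (\sum_i r i * (expR (s * a i) - 1) - s * c))%:E)%E.
  pose J (f : {ffun I -> 'I_L}) := [set w | forall i, M w (B i) = (f i)%:R%:E].
  pose Q := [pred f : {ffun I -> 'I_L} | c < \sum_i a i * (f i)%:R].
  have mJ f : measurable (J f).
    rewrite (_ : J f =
        \bigcap_(i in [set: I]) [set w | M w (B i) = (f i)%:R%:E]).
      apply: fin_bigcap_measurable; first exact: finite_finset.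
      by move=> i _; exact: measurable_count.
    by apply/seteqP; split => w /= h; [move=> i _|move=> i]; exact: h.
  (* Either some count is not below L, or the counts are given by one of the
     finitely many functions f with c < \sum_i a i * f i. *)
  have cover : S `<=` \bigcup_(i in [set` [pred _ : I | true]]) overflow L (B i) `|`
      \bigcup_(f in [set` Q]) J f.
    move=> w Sw.
    have [/choice[f fP]|/existsNP[i]] := pselect (forall i, exists k : 'I_L,
        M w (B i) = k%:R%:E); last first.
      move=> h; left; exists i => // -[k /= kL Mk].
      by apply: h; exists (Ordinal kL).
    right; exists [ffun i => f i]; last by move=> i; rewrite ffunE fP.
    move: Sw; rewrite /S /= inE -lte_fin -sumEFin.
    under eq_bigr do rewrite fP.
    by under [X in _ -> (_ < X)%E]eq_bigr do rewrite ffunE.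
  have moverflow i : measurable (overflow L (B i)) by exact: measurable_overflow.
  have mU (T : finType) (q : pred T) (F : T -> set Omega) :
      (forall i, measurable (F i)) -> measurable (\bigcup_(i in [set` q]) F i).
    by move=> mF; rewrite bigcup_pred; exact: bigsetU_measurable.
  apply: le_trans (le_measure P _ _ cover) _; rewrite ?inE//.
    by apply: measurableU; exact: mU.
  apply: le_trans (measureU2 P _ _) _; [exact: mU|exact: mU|].
  rewrite EFinD; apply: leeD.
    apply: le_trans (probability_fin_bigcup_le _ _ _) _ => //.
    by rewrite -sumEFin; apply: lee_sum => i _; rewrite (overflow_prob _ _ (r0 i)).
  apply: le_trans (probability_fin_bigcup_le _ _ _) _ => //.
  under eq_bigr do rewrite (joint_count_prob _ mB tB r0 nuB).
  rewrite sumEFin lee_fin.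
  (* For f in Q the factor exp(s (\sum_i a i * f i - c)) is at least 1. *)
  apply: (@le_trans _ _ (\sum_(f : {ffun I -> 'I_L})
    expR (- (s * c)) *
      \prod_i (poisson_weight (r i) (f i) * expR (s * a i) ^+ f i))).
    rewrite big_mkcond /=; apply: ler_sum => f _.
    have w0 : 0 <= \prod_i poisson_weight (r i) (f i).
      by apply: prodr_ge0 => i _; exact: poisson_weight_ge0.
    rewrite [X in _ <= _ * X]big_split /=.
    have -> : \prod_i expR (s * a i) ^+ f i = expR (s * \sum_i a i * (f i)%:R).
      rewrite mulr_sumr expR_sum; apply: eq_bigr => i _.
      by rewrite mulrA expRM_natr.
    rewrite mulrCA -expRD; case: ifPn => Qf; last first.
      by rewrite mulr_ge0// expR_ge0.
    rewrite ler_peMr// -[X in X <= _]expR0 ler_expR addrC subr_ge0 ler_wpM2l//.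
    exact: (ltW (Qf : c < _)).
  rewrite -mulr_sumr -(bigA_distr_bigA (fun i (k : 'I_L) =>
    poisson_weight (r i) k * expR (s * a i) ^+ k)).
  rewrite addrC expRD ler_pM2l ?expR_gt0// expR_sum.
  apply: ler_prod => i _; apply/andP; split.
    apply: sumr_ge0 => k _.
    by rewrite mulr_ge0 ?poisson_weight_ge0 ?exprn_ge0 ?expR_ge0.
  exact/poisson_laplace_le/expR_ge0.
have PS : P S \is a fin_num by exact: fin_num_measure.
rewrite -(fineK PS) lee_fin.
apply: (@cvgr_to_ge _ \oo _ _ (fun L =>
  \sum_i (1 - \sum_(k < L) poisson_weight (r i) k) +
    expR (\sum_i r i * (expR (s * a i) - 1) - s * c))); last first.
  by apply: nearW => L; rewrite -lee_fin fineK.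
rewrite -[X in _ --> X]add0r; apply: cvgD; last exact: cvg_cst.
rewrite [X in _ --> X](_ : 0 = \sum_(i : I) 0); last by rewrite big1.
apply: cvg_big => [|i _]; first exact: add_continuous.
exact: poisson_weight_total.
Qed.
End counts.

(** * The intensity of the point process on rectangles and cells *)

(** The measure of the sections of a rectangle is a multiple of an indicator
    function; hence the product formula holds for an arbitrary second factor,
    as is needed for Lambda. *)
Lemma product_measure1_setX d1 d2 (T1 : measurableType d1)
    (T2 : measurableType d2) (R : realType) (m1 : {measure set T1 -> \bar R})
    (m2 : {measure set T2 -> \bar R}) (A : set T1) (B : set T2) :
  measurable A -> measurable B -> (m1 \x m2)%E (A `*` B) = (m1 A * m2 B)%E.
Proof.
move=> mA mB; rewrite /product_measure1 /=.
rewrite (eq_integral (fun x => (\1_A x)%:E * m2 B)%E); last first.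
  by move=> x _; rewrite indicE; have [xA|xA] /= := boolP (x \in A);
    [rewrite in_xsectionX// mul1e|rewrite mul0e notin_xsectionX].
rewrite ge0_integralZr ?integral_indic ?setIT//; exact: measurableT_comp.
Qed.

Section intensity.
Variables (R : realType) (Pi Lambda : {measure set (measurableTypeR R) -> \bar R}).

Lemma supOU_intensity_setX (A B C : set (measurableTypeR R)) :
  measurable A -> measurable B -> measurable C ->
  supOU_intensity Pi Lambda (A `*` B `*` C) =
  (Pi A * lebesgue_measure (B : set R) * Lambda C)%E.
Proof.
move=> mA mB mC; have mAB := measurableX mA mB.
rewrite -[lebesgue_measure B]/(@lebesgue_measure R B).
rewrite -(product_measure1_setX Pi (@lebesgue_measure R) mA mB).
exact: (product_measure1_setX
  ((Pi \x @lebesgue_measure R)%E : {measure set _ -> \bar R}) Lambda).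
Qed.
End intensity.

Section cells.
Variable R : realType.
Implicit Types (x s z t T K : R) (i m j : nat).

(** The set where 1/x lies in [j, j+1), written without division so that
    j = 0 is the unbounded set x > 1. *)
Definition band j : set R := [set x | 0 < x /\ j%:R * x <= 1 < j.+1%:R * x].

(** Windows are numbered backwards in time from (T, T+1]: the process on
    [T, T+1] only sees jumps that occur in them. *)
Definition window T m : set R := `]T - m%:R, T - m%:R + 1]%classic.

Definition cell T i m j : set (state R) := band i `*` window T m `*` band j.

(** An upper bound for exp(-x (t-s)) z on the cell (i, m, j) when t >= T and
    z <= K.  Jumps in window m have age at least m - 1, and at least 0 for
    m = 0, whence the predecessor; on band j, z is at most K if j = 0, and at
    most 1/j <= 2/(j+1) otherwise. *)
Definition weight K i m j : R :=
  expR (- (m.-1%:R / i.+1%:R)) * (2 * K / j.+1%:R).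

Lemma measurable_band j : measurable (band j : set (measurableTypeR R)).
Proof.
have mle k : measurable ([set: measurableTypeR R] `&` [set x : R | k%:R * x <= 1]).
  by apply: measurable_fun_le => //; apply: (measurable_funM (f := cst k%:R)).
rewrite (_ : band j = `]0, +oo[%classic `&`
  ((setT `&` [set x : R | j%:R * x <= 1]) `\`
   (setT `&` [set x : R | j.+1%:R * x <= 1]))).
  by apply: measurableI; [exact: measurable_itv|exact: measurableD].
apply/seteqP; split=> x /=; rewrite in_itv/= andbT.
  by move=> [x0 /andP[a b]]; do 2!split => //; move=> [_]; rewrite leNgt b.
move=> [x0 [[_ a] b]]; split => //; rewrite a/= ltNge; apply/negP => c.
exact: b.
Qed.

Lemma measurable_cell T i m j : measurable (cell T i m j).
Proof.
apply: measurableX; last exact: measurable_band.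
by apply: measurableX; [exact: measurable_band|exact: measurable_itv].
Qed.

Lemma band_inj x i j : band i x -> band j x -> i = j.
Proof.
move=> [x0 /andP[a b]] [_ /andP[c e]]; apply/eqP; rewrite eqn_leq.
rewrite -ltnS -(ltr_nat R) -(ltr_pM2r x0) (le_lt_trans a e)/=.
by rewrite -ltnS -(ltr_nat R) -(ltr_pM2r x0) (le_lt_trans c b).
Qed.

Lemma window_inj T s i j : window T i s -> window T j s -> i = j.
Proof.
rewrite /window /= !in_itv/= => /andP[a b] /andP[c e].
have H k l : T - k%:R < s -> s <= T - l%:R + 1 -> (l <= k)%N.
  move=> h1 h2; rewrite -ltnS -(ltr_nat R) -[k.+1]addn1 natrD; lra.
by apply/eqP; rewrite eqn_leq (H j i)// (H i j).
Qed.

Lemma cell_inj T (p : state R) i m j i' m' j' :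
  cell T i m j p -> cell T i' m' j' p -> (i, m, j) = (i', m', j').
Proof.
move=> [[/= a b] c] [[/= a' b'] c'].
by rewrite (band_inj a a') (window_inj b b') (band_inj c c').
Qed.

Lemma band_cover x : 0 < x -> exists j, band j x.
Proof.
move=> x0; exists (Num.trunc x^-1); split => //.
have [/truncn_itv/andP[a b]] : 0 <= x^-1 by rewrite invr_ge0 ltW.
by rewrite -ler_pdivlMr// div1r a/= -ltr_pdivrMr// div1r.
Qed.

Lemma window_cover T s : s <= T + 1 -> exists m, window T m s.
Proof.
move=> sT; have /truncn_itv/andP[a b] : 0 <= T + 1 - s by rewrite subr_ge0.
exists (Num.trunc (T + 1 - s)); rewrite /window /= in_itv/=.
move: b; rewrite -[_.+1]addn1 natrD => b; apply/andP; split; lra.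
Qed.

Lemma lebesgue_window T m : lebesgue_measure (window T m) = 1%E :> \bar R.
Proof.
rewrite lebesgue_measure_itv /= lte_fin ltrDl ltr01 -EFinD.
by congr (_%:E); ring.
Qed.

Lemma supOU_kernel_le_weight K T t x s z i m j : 1 <= K -> z <= K -> T <= t ->
  s <= t -> cell T i m j (x, s, z) ->
  expR (- x * (t - s)) * z <= weight K i m j.
Proof.
move=> K1 zK Tt st [[/= [x0 /andP[_ ix]]]].
rewrite /window /= in_itv/= => /andP[_ sm] [z0 /andP[jz _]].
apply: ler_pM; rewrite ?expR_ge0 ?(ltW z0)//.
  rewrite ler_expR mulNr lerN2 ler_pdivrMr ?ltr0n//.
  have h : m.-1%:R <= t - s :> R.
    case: m sm => [|m] sm; first by rewrite subr_ge0.
    move: sm; rewrite -[m.+1]addn1 natrD addn1/=; lra.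
  apply: le_trans h _; rewrite mulrAC ler_peMl ?subr_ge0// mulrC.
  exact: ltW.
rewrite ler_pdivlMr ?ltr0n// -[j.+1]addn1 natrD mulrDr mulr1.
by case: j jz => [|j] jz; [rewrite mulr0 add0r|]; nra.
Qed.

(** A geometric series of ratio q = exp(-1/(i+1)) <= (i+1)/(i+2), plus the
    additional term 1 of the window (T, T+1]. *)
Lemma sum_exp_window_le i N :
  \sum_(m < N) expR (- (m.-1%:R / i.+1%:R)) <= i%:R + 3 :> R.
Proof.
case: N => [|N]; first by rewrite big_ord0.
rewrite big_ord_recl /= mul0r oppr0 expR0.
set q := expR (- i.+1%:R^-1 : R).
have -> : \sum_(m < N) expR (- (m%:R / i.+1%:R)) = \sum_(m < N) q ^+ m.
  by apply: eq_bigr => m _; rewrite /q -expRM_natr mulrC mulNr.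
have n0 : 0 < i.+1%:R :> R by rewrite ltr0n.
have -> : i%:R + 3 = 1 + (i.+1%:R + 1) :> R by rewrite -[i.+1]addn1 natrD; lra.
rewrite lerD2l; set n : R := i.+1%:R.
have e : n + 1 <= n * expR n^-1.
  rewrite -[X in n + X](mulfV (lt0r_neq0 n0)) -[X in X + _](mulr1 n) -mulrDr.
  by rewrite ler_pM2l// expR_ge1Dx.
have q0 : 0 < q by exact: expR_gt0.
have qn : q * (n + 1) <= n.
  apply: le_trans (ler_wpM2l (ltW q0) e) _.
  by rewrite mulrCA /q expRN mulVf ?mulr1// gt_eqF ?expR_gt0.
have S0 : 0 <= \sum_(m < N) q ^+ m.
  by apply: sumr_ge0 => k _; rewrite exprn_ge0 ?ltW.
have : 0 <= q ^+ N by rewrite exprn_ge0 ?ltW.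
have := subrX1 q N; move: (\sum_(m < N) _) S0 (q ^+ N) => S S0 p E p0.
have : S * 1 <= S * ((1 - q) * (n + 1)) by apply: ler_wpM2l => //; lra.
have -> : S * ((1 - q) * (n + 1)) = (1 - p) * (n + 1).
  by rewrite mulrA; congr (_ * _); lra.
by rewrite mulr1 => /le_trans; apply; rewrite ler_piMl//; lra.
Qed.

(** The bands are disjoint and the step function with values a j lies below
    g. *)
Lemma sum_band_le (Q : {measure set (measurableTypeR R) -> \bar R})
    (a : nat -> R) (g : R -> R) N :
  measurable_fun [set: measurableTypeR R] g ->
  (forall x, 0 < x -> 0 <= g x) -> (forall j, 0 <= a j) ->
  (forall j x, band j x -> a j <= g x) ->
  (\sum_(j < N) (a j)%:E * Q (band j) <=
   \int[Q]_(x in `]0%R, +oo[) (g x)%:E)%E.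
Proof.
move=> mg g0 a0 ag.
have mgE D : measurable D ->
    measurable_fun D (fun x : measurableTypeR R => (g x)%:E).
  by move=> mD; apply/measurable_EFinP; exact: measurable_funTS.
pose U : set (measurableTypeR R) :=
  \big[setU/set0]_(j <- index_enum 'I_N) (band j : set (measurableTypeR R)).
have mU : measurable U.
  by apply: bigsetU_measurable => j _; exact: measurable_band.
have subU : U `<=` `]0, +oo[%classic.
  by rewrite /U -bigcup_mkord => x [j _ []] x0 _; rewrite /= in_itv/= x0.
apply: (@le_trans _ _ (\int[Q]_(x in U) (g x)%:E)%E); last first.
  apply: ge0_subset_integral => //; first exact: mgE.
  by move=> x; rewrite /= in_itv/= andbT lee_fin; exact: g0.
rewrite ge0_integral_bigsetU//.
- apply: lee_sum => j _; rewrite -integral_cst; last exact: measurable_band.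
  apply: ge0_le_integral.
  + exact: measurable_band.
  + by move=> x _; rewrite lee_fin.
  + exact: measurable_cst.
  + by apply: mgE; exact: measurable_band.
  + by move=> x /ag; rewrite lee_fin.
- by move=> j; exact: measurable_band.
- exact: index_enum_uniq.
- by move=> i j _ _ [x [/= a1 b1]]; apply: val_inj; exact: band_inj a1 b1.
- exact: mgE.
- by move=> x /subU; rewrite /= in_itv/= andbT lee_fin; exact: g0.
Qed.

End cells.

Lemma band_sum_bounded_fin (R : realType)
    (Q : {measure set (measurableTypeR R) -> \bar R}) (a : nat -> R) (b : \bar R) :
  (forall j, 0 < a j) -> (b < +oo)%E ->
  (forall N, (\sum_(j < N) (a j)%:E * Q (band j) <= b)%E) ->
  (forall j, Q (band j) \is a fin_num) /\
  (forall N, \sum_(j < N) a j * fine (Q (band j)) <= fine b).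
Proof.
move=> a0 boo ub.
have Qfin j : Q (band j) \is a fin_num.
  rewrite ge0_fin_numE//.
  have h : ((a j)%:E * Q (band j) < +oo)%E.
    apply: le_lt_trans boo; apply: le_trans (ub j.+1).
    rewrite big_ord_recr /= leeDr//; apply: sume_ge0 => k _.
    by rewrite mule_ge0// lee_fin ltW.
  rewrite ltey; apply/eqP => Qoo; move: h.
  by rewrite Qoo gt0_muley ?ltxx// lte_fin.
split=> // N; rewrite -lee_fin fineK; last first.
  rewrite ge0_fin_numE//; apply: le_trans (ub 0%N); by rewrite big_ord0.
rewrite -sumEFin; apply: le_trans (ub N).
by apply: lee_sum => j _; rewrite EFinM fineK.
Qed.

Section masses.
Variables (R : realType) (Pi Lambda : {measure set (measurableTypeR R) -> \bar R}).

(** On band i, i + 3 <= 1/x + 3. *)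
Lemma Pi_band_sum : (moment (-1) Pi < +oo)%E -> (moment 0 Pi < +oo)%E ->
  exists2 b : \bar R, (b < +oo)%E &
    forall N, (\sum_(i < N) (i%:R + 3 : R)%:E * Pi (band i) <= b)%E.
Proof.
move=> Pi1 Pi0; exists (moment (-1) Pi + 3%:E * moment 0 Pi)%E.
  by rewrite lte_add_pinfty// lte_mul_pinfty.
move=> N; rewrite /moment.
have mp p : measurable_fun (`]0, +oo[ : set (measurableTypeR R))
    (fun x : measurableTypeR R => (x `^ p)%:E).
  by apply/measurable_EFinP/measurable_funTS; exact: measurable_powR.
have p0 p (x : measurableTypeR R) : `]0, +oo[%classic x -> (0 <= (x `^ p)%:E)%E.
  by move=> _; rewrite lee_fin powR_ge0.
have -> : (\int[Pi]_(x in `]0%R, +oo[) (x `^ (-1))%:E +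
    3%:E * \int[Pi]_(x in `]0%R, +oo[) (x `^ 0)%:E =
    \int[Pi]_(x in `]0%R, +oo[) (x `^ (-1) + 3 * x `^ 0)%:E)%E.
  under [RHS]eq_integral do rewrite EFinD EFinM.
  rewrite ge0_integralD//.
  - by rewrite ge0_integralZl_EFin//; exact: p0.
  - exact: p0.
  - by move=> x x0; rewrite mule_ge0 ?p0// lee_fin.
  - by apply: measurable_funeM.
apply: (@sum_band_le _ Pi (fun i => i%:R + 3) (fun x => x `^ (-1) + 3 * x `^ 0)).
- apply: measurable_funD; first exact: measurable_powR.
  apply: (measurable_funM (f := cst 3)) => //; exact: measurable_powR.
- by move=> x _; rewrite addr_ge0 ?mulr_ge0 ?powR_ge0.
- by move=> i; rewrite addr_ge0.
- move=> i x [x0 /andP[ix _]] /=; rewrite (powR_inv1 (ltW x0)) powRr0 mulr1 lerD2r.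
  by rewrite -[x^-1]mul1r ler_pdivlMr.
Qed.

(** On band j, 1/(j+1) <= min(1, z), and min(1, z) is integrable: it is z
    on (0, 1], and it equals min(1, z^2) on (1, +oo). *)
Lemma Lambda_band_sum : Levy_measure Lambda ->
  (\int[Lambda]_(z in `]0%R, 1%R]) z%:E < +oo)%E ->
  exists2 b : \bar R, (b < +oo)%E &
    forall N, (\sum_(j < N) (j.+1%:R^-1 : R)%:E * Lambda (band j) <= b)%E.
Proof.
move=> [_ L2] L1.
pose g (z : R) := Num.min 1 z.
have mg : measurable_fun [set: measurableTypeR R] g.
  by apply: measurable_minr; [exact: measurable_cst|exact: measurable_id].
exists (\int[Lambda]_(z in `]0%R, +oo[) (g z)%:E)%E; last first.
  move=> N; apply: (@sum_band_le _ Lambda (fun j => j.+1%:R^-1) g) => //.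
  - by move=> x x0; rewrite /g le_min ler01 ltW.
  - move=> j x [x0 /andP[_ jx]]; rewrite /g le_min invf_le1 ?ltr0n// ler1n/=.
    by rewrite -[_^-1]mul1r ler_pdivrMr ?ltr0n// mulrC ltW.
have -> : `]0, +oo[%classic = `]0, 1]%classic `|` `]1, +oo[%classic :> set R.
  by rewrite -itv_bndbnd_setU// ?bnd_simp.
have mgE D : measurable D ->
    measurable_fun D (fun z : measurableTypeR R => (g z)%:E).
  by move=> mD; apply/measurable_EFinP; exact: measurable_funTS.
rewrite ge0_integral_setU//=.
- apply: lte_add_pinfty.
    apply: le_lt_trans L1; apply: ge0_le_integral => //.
    + move=> z; rewrite /= in_itv/= => /andP[z0 _].
      by rewrite lee_fin le_min ler01 ltW.
    + exact: mgE.
    + by move=> z _; rewrite lee_fin ge_min lexx orbT.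
  pose h (z : R) : R := Num.min 1 (z ^+ 2).
  have mh : measurable_fun [set: measurableTypeR R] h.
    apply: measurable_minr; first exact: measurable_cst.
    by apply: measurable_funX; exact: measurable_id.
  have mhE D : measurable D ->
      measurable_fun D (fun z : measurableTypeR R => (h z)%:E).
    by move=> mD; apply/measurable_EFinP; exact: measurable_funTS.
  have h0 (z : R) : (0 <= (h z)%:E)%E.
    by rewrite lee_fin le_min ler01 sqr_ge0.
  apply: le_lt_trans L2. apply: (@le_trans _ _
      (\int[Lambda]_(z in `]1%R, +oo[) (h z)%:E)%E).
    apply: ge0_le_integral => //.
    + move=> z; rewrite /= in_itv/= andbT => z1.
      by rewrite lee_fin le_min ler01 (le_trans ler01 (ltW z1)).
    + exact: mgE.
    + exact: mhE.
    + move=> z; rewrite /= in_itv/= andbT => z1; rewrite lee_fin /g /h.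
      by rewrite (min_l (ltW z1)) min_l// exprn_ege1// ltW.
  apply: ge0_subset_integral => //; first exact: mhE.
  by move=> z; rewrite /= !in_itv/= !andbT; exact: lt_trans.
- apply: mgE; exact: measurableU.
- move=> z; rewrite /= !in_itv/= => -[/andP[z0 _]|/andP[z1 _]];
    by rewrite lee_fin le_min ler01 ltW// (lt_trans ltr01).
- rewrite disj_set2E; apply/eqP/seteqP; split => // z [].
  by rewrite /= !in_itv/= andbT => /andP[_]; rewrite leNgt => /negP.
Qed.

(** The mean of the dominating sum is bounded uniformly in T and in the size of
    the cube, because the sums over i, m and j factor: the windows contribute
    at most i + 3 <= 1/x + 3 on band i, and the jumps at most a multiple of
    min(1, z). *)
Lemma cell_total_bounded (K : R) : 1 <= K ->
  (moment (-1) Pi < +oo)%E -> (moment 0 Pi < +oo)%E ->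
  Levy_measure Lambda -> (\int[Lambda]_(z in `]0%R, 1%R]) z%:E < +oo)%E ->
  exists r : nat -> nat -> R, exists2 D : R, 0 <= D &
  [/\ forall i j, 0 <= r i j,
      forall T i m j, supOU_intensity Pi Lambda (cell T i m j) = (r i j)%:E &
      forall N, \sum_(c : 'I_N * 'I_N * 'I_N)
         r c.1.1 c.2 * weight K c.1.1 c.1.2 c.2 <= D].
Proof.
move=> K1 Pi1 Pi0 L2 L1.
have [bP bPoo ubP] := Pi_band_sum Pi1 Pi0.
have [|Pfin Psum] := @band_sum_bounded_fin _ _ (fun i => i%:R + 3) _ _ bPoo ubP.
  by move=> i; rewrite ltr_wpDl.
have [bL bLoo ubL] := Lambda_band_sum L2 L1.
have [|Lfin Lsum] :=
  @band_sum_bounded_fin _ _ (fun j => j.+1%:R^-1) _ _ bLoo ubL.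
  by move=> i; rewrite invr_gt0 ltr0n.
pose p i := fine (Pi (band i)); pose l j := fine (Lambda (band j)).
have p0 i : 0 <= p i by rewrite fine_ge0.
have l0 i : 0 <= l i by rewrite fine_ge0.
have bP0 : 0 <= fine bP by apply: le_trans (Psum 0%N); rewrite big_ord0.
have bL0 : 0 <= fine bL by apply: le_trans (Lsum 0%N); rewrite big_ord0.
exists (fun i j => p i * l j), (fine bP * (2 * K * fine bL)).
  by rewrite !mulr_ge0//; lra.
split => [i j|T i m j|N]; first by rewrite mulr_ge0.
  rewrite supOU_intensity_setX;
    [|exact: measurable_band|exact: measurable_itv|exact: measurable_band].
  by rewrite [X in (_ * X * _)%E]lebesgue_window mule1 EFinM !fineK.
rewrite -(pair_bigA _ (fun (q : 'I_N * 'I_N) (j : 'I_N) =>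
  p q.1 * l j * weight K q.1 q.2 j))/=.
rewrite -(pair_bigA _ (fun (i m : 'I_N) =>
  \sum_(j < N) p i * l j * weight K i m j))/=.
have -> : \sum_(i < N) \sum_(m < N) \sum_(j < N) p i * l j * weight K i m j =
    (\sum_(i < N) p i * \sum_(m < N) expR (- (m.-1%:R / i.+1%:R))) *
    (2 * K * \sum_(j < N) j.+1%:R^-1 * l j).
  rewrite mulr_suml; apply: eq_bigr => i _.
  rewrite mulr_sumr mulr_suml; apply: eq_bigr => m _.
  rewrite mulr_sumr mulr_sumr; apply: eq_bigr => j _.
  by rewrite /weight; ring.
apply: ler_pM.
- apply: sumr_ge0 => i _; rewrite mulr_ge0//.
  by apply: sumr_ge0 => m _; exact: expR_ge0.
- rewrite mulr_ge0//; first by lra.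
  by apply: sumr_ge0 => j _; rewrite mulr_ge0.
- apply: le_trans (Psum N); apply: ler_sum => i _.
  by rewrite mulrC ler_wpM2r// sum_exp_window_le.
- rewrite ler_wpM2l//; lra.
Qed.
End masses.

(** * Domination of the process by sums of cell counts *)

Section points.
Context d (Omega : measurableType d) (R : realType).
Variables (xi tau zeta : nat -> Omega -> measurableTypeR R).
Implicit Types (w : Omega) (B : set (state R)).

Local Notation point k w := ((xi k w, tau k w, zeta k w) : state R).
Local Notation M := (point_measure xi tau zeta).

Lemma point_measure_ge_sum w B N : (\sum_(k < N) \d_(point k w) B <= M w B)%E.
Proof.
rewrite -(big_mkord xpredT (fun k => \d_(point k w) B)).
exact: nneseries_lim_ge.
Qed.

Lemma point_measure0_notin w B k : M w B = 0%E -> ~ B (point k w).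
Proof.
move=> M0 Bk; have := point_measure_ge_sum w B k.+1.
rewrite M0 big_ord_recr/= diracE mem_set//; apply/negP; rewrite -ltNge.
by rewrite lte_paddl// sume_ge0.
Qed.

(** The pathwise bounds hold for tame configurations, which are almost sure. *)
Definition tame K w := forall k, [/\ 0 < xi k w, 0 < zeta k w & zeta k w <= K].

(** Dominates the process on [T, T+1] as N tends to infinity. *)
Definition cell_sum K T N w : \bar R := (\sum_(c : 'I_N * 'I_N * 'I_N)
  (weight K c.1.1 c.1.2 c.2)%:E * M w (cell T c.1.1 c.1.2 c.2))%E.

Lemma weight_ge0 (K : R) i m j : 1 <= K -> 0 <= weight K i m j.
Proof.
move=> K1; rewrite /weight mulr_ge0 ?expR_ge0// divr_ge0// mulr_ge0//.
by rewrite (le_trans ler01).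
Qed.

Lemma weight_le (K : R) i m j : 1 <= K -> weight K i m j <= 2 * K.
Proof.
move=> K1; have K0 : 0 <= 2 * K by rewrite mulr_ge0 ?(le_trans _ K1).
rewrite /weight -[leRHS]mul1r; apply: ler_pM.
- exact: expR_ge0.
- exact: divr_ge0.
- by rewrite -[leRHS]expR0 ler_expR oppr_le0 divr_ge0.
- by rewrite ler_piMr// invf_le1 ?ltr0n// ler1n.
Qed.

Lemma supOU_term_le_cell_sum K T t k w : 1 <= K -> tame K w ->
  T <= t <= T + 1 -> tau k w <= t ->
  exists N0, forall N, (N0 <= N)%N ->
    ((expR (- xi k w * (t - tau k w)) * zeta k w)%:E <=
     \sum_(c : 'I_N * 'I_N * 'I_N) (weight K c.1.1 c.1.2 c.2)%:E *
       \d_(point k w) (cell T c.1.1 c.1.2 c.2))%E.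
Proof.
move=> K1 /(_ k)[x0 z0 zK] /andP[Tt tT] st.
have [i ik] := band_cover x0; have [j jk] := band_cover z0.
have [m mk] := window_cover (le_trans st tT).
exists (i + m + j).+1 => N iN.
have iN' : (i < N)%N by apply: leq_trans iN; rewrite ltnS -addnA leq_addr.
have mN' : (m < N)%N by apply: leq_trans iN; rewrite ltnS addnAC leq_addl.
have jN' : (j < N)%N by apply: leq_trans iN; rewrite ltnS leq_addl.
rewrite (bigD1 (Ordinal iN', Ordinal mN', Ordinal jN'))//=.
apply: le_trans (leeDl _ _); last first.
  apply: sume_ge0 => c _; rewrite mule_ge0// lee_fin; exact: weight_ge0.
rewrite diracE mem_set ?mule1 ?lee_fin.
  exact: (supOU_kernel_le_weight K1 zK Tt st).
by [].
Qed.

(** If the series X(t) exceeds c then so does a finite partial sum, and its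
    finitely many points lie in the cells of all large enough cubes. *)
Lemma supOU_gt_cell_sum K T t c w : 1 <= K -> tame K w ->
  T <= t <= T + 1 -> (c < supOU xi tau zeta t w)%E ->
  exists N0, forall N, (N0 <= N)%N -> (c < cell_sum K T N w)%E.
Proof.
move=> K1 tw tT cX.
pose u k := (expR (- xi k w * (t - tau k w)) * zeta k w)%:E.
have u0 k : (0 <= u k)%E.
  by have [_ z0 _] := tw k; rewrite lee_fin mulr_ge0 ?expR_ge0 ?ltW.
have [n cn] : exists n, (c < \sum_(0 <= k < n | (tau k w <= t)%R) u k)%E.
  apply/not_existsP => h; move: cX; apply/negP; rewrite -leNgt.
  apply: lime_le; first by apply: is_cvg_nneseries => k _ _; exact: u0.
  by apply: nearW => n; rewrite leNgt; apply/negP; exact: h.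
have [N0 N0P] : exists N0, forall N, (N0 <= N)%N -> forall k, (k < n)%N ->
    tau k w <= t -> (u k <= \sum_(c : 'I_N * 'I_N * 'I_N)
      (weight K c.1.1 c.1.2 c.2)%:E *
       \d_(point k w) (cell T c.1.1 c.1.2 c.2))%E.
  elim: (n) => [|n' [N1 IH]]; first by exists 0%N.
  have [st|st] := boolP (tau n' w <= t); last first.
    exists N1 => N /IH h k; rewrite ltnS leq_eqVlt => /predU1P[->|kn]; last exact: h.
    by move=> st'; rewrite st' in st.
  have [N2 N2P] := supOU_term_le_cell_sum K1 tw tT st.
  exists (maxn N1 N2) => N; rewrite geq_max => /andP[/IH h /N2P h2] k.
  by rewrite ltnS leq_eqVlt => /predU1P[->//|kn]; exact: h.
exists N0 => N /N0P NP; apply: (lt_le_trans cn).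
rewrite big_mkord.
apply: (@le_trans _ _ (\sum_(k < n) \sum_(c : 'I_N * 'I_N * 'I_N)
  (weight K c.1.1 c.1.2 c.2)%:E * \d_(point k w) (cell T c.1.1 c.1.2 c.2))%E).
  rewrite big_mkcond; apply: lee_sum => k _; case: ifPn => [st|_].
    exact: NP.
  by apply: sume_ge0 => i _; rewrite mule_ge0// lee_fin; exact: weight_ge0.
rewrite exchange_big/=; apply: lee_sum => i _.
rewrite -ge0_sume_distrr//; apply: lee_wpmul2l.
  by rewrite lee_fin; exact: weight_ge0.
exact: point_measure_ge_sum.
Qed.

Variables (P : probability Omega R).
Variables (Pi Lambda : {measure set (measurableTypeR R) -> \bar R}).
Hypothesis prmM : Poisson_random_measure P (supOU_intensity Pi Lambda) M.

(** The half-spaces that tame points avoid have zero intensity. *)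
Lemma negligible_not_tame K : concentrated_on_pos Pi ->
  concentrated_on_pos Lambda -> tail Lambda K = 0%E ->
  P.-negligible [set w | ~ tame K w].
Proof.
move=> Pi0 La0 LaK.
pose A := `]-oo, (0 : R)]%classic : set (measurableTypeR R).
pose C := `]K, +oo[%classic : set (measurableTypeR R).
have mA : measurable A by exact: measurable_itv.
have mC : measurable C by exact: measurable_itv.
have null (D E F : set (measurableTypeR R)) : measurable D -> measurable E ->
    measurable F -> (Pi D = 0 \/ Lambda F = 0)%E ->
    P.-negligible [set w | M w (D `*` E `*` F) <> 0%E].
  move=> mD mE mF H; apply: (count_null prmM).
    by apply: measurableX => //; exact: measurableX.
  by rewrite supOU_intensity_setX//; case: H => ->; rewrite ?mule0 ?mul0e.
have n1 := null A setT setT mA measurableT measurableT (or_introl Pi0).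
have n2 := null setT setT A measurableT measurableT mA (or_intror La0).
have n3 := null setT setT C measurableT measurableT mC (or_intror LaK).
apply: negligibleS (negligibleU n1 (negligibleU n2 n3)).
move=> w /=; apply: contra_notP.
move=> /not_orP[/contrapT m1 /not_orP[/contrapT m2 /contrapT m3]] k.
split.
- rewrite ltNge; apply/negP => x0; apply: (point_measure0_notin m1 (k := k)).
  by do 2!split => //; rewrite /A /= in_itv.
- rewrite ltNge; apply/negP => x0; apply: (point_measure0_notin m2 (k := k)).
  by split; [split|rewrite /A /= in_itv].
- rewrite leNgt; apply/negP => x0; apply: (point_measure0_notin m3 (k := k)).
  by split; [split|rewrite /C /= in_itv/= x0].
Qed.

(** The union over N0 is increasing and each of its terms lies in the event
    that one single finite sum of cell counts exceeds c, so that a bound on the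
    latter, uniform in N, passes to the union. *)
Definition exceed K T c : set Omega :=
  \bigcup_N0 \bigcap_(N in [set N | (N0 <= N)%N]) [set w | (c < cell_sum K T N w)%E].

Lemma measurable_cell_sum K T N : measurable_fun [set: Omega] (cell_sum K T N).
Proof.
apply: emeasurable_sum => i; apply: emeasurable_funM => //.
by apply: (prm_measurable prmM); exact: measurable_cell.
Qed.

Lemma measurable_cell_sum_gt K T N c : measurable [set w | (c < cell_sum K T N w)%E].
Proof.
rewrite -[mkset _]setTI; apply: emeasurable_fun_o_infty => //.
exact: measurable_cell_sum.
Qed.

Lemma measurable_exceed K T c : measurable (exceed K T c).
Proof.
apply: bigcup_measurable => N0 _; apply: bigcap_measurable => [|N _].
  by exists N0 => /=.
exact: measurable_cell_sum_gt.
Qed.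

(** The Chernoff bound, with exp(y) - 1 <= y exp(y) and weights at most 2 K
    to make the exponent linear in the mean D of the dominating sum. *)
Lemma exceed_prob_le K T c (s D : R) (r : nat -> nat -> R) : 1 <= K -> 0 <= s ->
  (forall i j, 0 <= r i j) ->
  (forall i m j, supOU_intensity Pi Lambda (cell T i m j) = (r i j)%:E) ->
  (forall N, \sum_(c : 'I_N * 'I_N * 'I_N)
     r c.1.1 c.2 * weight K c.1.1 c.1.2 c.2 <= D) ->
  (P (exceed K T c%:E) <= (expR (s * expR (s * (2 * K)) * D - s * c))%:E)%E.
Proof.
move=> K1 s0 r0 nuE rD; set b := expR _.
have Nb N : (P [set w | (c%:E < cell_sum K T N w)%E] <= b%:E)%E.
  pose I := ('I_N * 'I_N * 'I_N)%type.
  have mB (i : I) : measurable (cell T i.1.1 i.1.2 i.2) by exact: measurable_cell.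
  have tB : trivIset [set: I] (fun i => cell T i.1.1 i.1.2 i.2).
    move=> [[i m] j] [[i' m'] j'] _ _ [p [/= h h']].
    by have [/val_inj -> /val_inj -> /val_inj ->] := cell_inj h h'.
  have H := poisson_chernoff prmM (fun i : I => weight K i.1.1 i.1.2 i.2) c mB tB
    (fun i => r0 i.1.1 i.2) (fun i => nuE i.1.1 i.1.2 i.2) s0.
  apply: (le_trans H).
  rewrite lee_fin ler_expR lerD2r.
  apply: (@le_trans _ _ (\sum_(c : 'I_N * 'I_N * 'I_N)
      (s * expR (s * (2 * K))) * (r c.1.1 c.2 * weight K c.1.1 c.1.2 c.2))).
    apply: ler_sum => i _; rewrite [leRHS]mulrCA; apply: ler_wpM2l; first exact: r0.
    have w0 := weight_ge0 i.1.1 i.1.2 i.2 K1.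
    have := weight_le i.1.1 i.1.2 i.2 K1; move: (weight _ _ _ _) w0 => a a0 aK.
    have h : expR (s * a) - 1 <= s * a * expR (s * a).
      have := expR_ge1Dx (- (s * a)); rewrite -(ler_pM2r (expR_gt0 (s * a))).
      rewrite -expRD addNr expR0; lra.
    apply: le_trans h _; rewrite -mulrA [leRHS]mulrAC -[leRHS]mulrA.
    rewrite ler_wpM2l// ler_wpM2l// ler_expR ler_wpM2l//.
  by rewrite -mulr_sumr ler_wpM2l// mulr_ge0 ?expR_ge0.
pose G N0 := \bigcap_(N in [set N | (N0 <= N)%N])
  [set w | (c%:E < cell_sum K T N w)%E].
have mG N : measurable (G N).
  apply: bigcap_measurable => [|k _]; first by exists N => /=.
  exact: measurable_cell_sum_gt.
have Gcvg : (P \o G) x @[x --> \oo] --> P (exceed K T c%:E).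
  apply: nondecreasing_cvg_mu => //; first exact: measurable_exceed.
  move=> m n mn; apply/subsetPset => w Gw k /= nk; apply: Gw => /=.
  exact: leq_trans nk.
rewrite -(cvg_lim _ Gcvg)//; apply: lime_le.
  by apply/cvg_ex; eexists; exact: Gcvg.
apply: nearW => N; apply: le_trans (Nb N).
apply: le_measure; rewrite ?inE//; first exact: measurable_cell_sum_gt.
by apply: bigcap_inf => /=.
Qed.

End points.

(** * The upper bound *)

Section asymptotics.
Variable R : realType.
Implicit Types (t : R) (n : nat).

(** With L = ln n, the choice of s makes exp(2 K s) the square root of L,
    and v <= 2 sqrt L absorbs the factor s of the first term, so that both
    terms are of order L; the constant 2 D + 8 K leaves - 2 L. *)
Lemma chernoff_exponent_le (K D L v s : R) : 1 <= K -> 0 <= D -> 1 < L ->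
  v = ln L -> s = v / (4 * K) ->
  s * expR (s * (2 * K)) * D - s * ((2 * D + 8 * K) * (L / v)) <= - (2 * L).
Proof.
move=> K1 D0 L1 vL sv.
have v0 : 0 < v by rewrite vL ln_gt0.
have K0 : 0 < K by apply: lt_le_trans K1.
have -> : s * (2 * K) = v / 2 by rewrite sv; field; rewrite gt_eqF.
set E := expR (v / 2).
have EL : E * E = L.
  by rewrite -expRD -splitr vL lnK// posrE (lt_trans ltr01).
have vE : v <= 2 * E.
  by have := expR_ge1Dx (v / 2); rewrite -/E; lra.
have E0 : 0 < E by exact: expR_gt0.
have -> : s * ((2 * D + 8 * K) * (L / v)) = D * L / (2 * K) + 2 * L.
  by rewrite sv; field; rewrite !gt_eqF.
suff : s * E * D <= D * L / (2 * K) by lra.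
rewrite -EL sv.
have -> : v / (4 * K) * E * D = v * (E * D / (4 * K)) by field; rewrite gt_eqF.
have -> : D * (E * E) / (2 * K) = (2 * E) * (E * D / (4 * K)).
  by field; rewrite gt_eqF.
by rewrite ler_wpM2r// divr_ge0// mulr_ge0// ltW.
Qed.

Lemma expR_lnN2 n : (0 < n)%N -> expR (- (2 * ln n%:R)) = (n%:R ^+ 2)^-1 :> R.
Proof.
move=> n0; rewrite expRN mulrC expRM_natr lnK// posrE ltr0n//.
Qed.

(** Between n and n + 1 the rate changes by a factor of at most 2, since
    ln t <= 2 ln n <= (ln n)^2. *)
Lemma rate_window_le (C t : R) n : 0 <= C -> (1 < n)%N -> 2 <= ln n%:R :> R ->
  n%:R <= t <= n%:R + 1 ->
  0 <= ln (ln t) / ln t /\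
  ln (ln t) / ln t * (C * (ln n%:R / ln (ln n%:R))) <= 2 * C.
Proof.
move=> C0 n1 n2 /andP[nt tn].
have n0 : 0 < n%:R :> R by rewrite ltr0n ltnW.
have t0 : 0 < t by exact: lt_le_trans nt.
set L := ln n%:R; have L0 : 0 < L by apply: lt_le_trans n2.
have LT : L <= ln t by rewrite ler_ln ?posrE.
have TL : ln t <= L ^+ 2.
  apply: (@le_trans _ _ (2 * L)); last by rewrite expr2 ler_wpM2r// ltW.
  rewrite mulrC mulr_natr -lnXn// ler_ln ?posrE ?exprn_gt0//.
  apply: le_trans tn _; have : 2 <= n%:R :> R by rewrite ler_nat.
  by rewrite expr2; nra.
have T0 : 0 < ln t by exact: lt_le_trans LT.
have v0 : 0 < ln L by apply: ln_gt0; apply: lt_le_trans n2; rewrite ltr1n.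
have Tv : ln (ln t) <= 2 * ln L.
  by rewrite mulrC mulr_natr -lnXn// ler_ln ?posrE ?exprn_gt0.
have Tv0 : 0 <= ln (ln t) by apply: le_trans (ltW v0) _; rewrite ler_ln ?posrE.
split; first by rewrite divr_ge0// ltW.
have -> : ln (ln t) / ln t * (C * (L / ln L)) =
    C * ((ln (ln t) / ln L) * (L / ln t)) by field; rewrite !gt_eqF.
rewrite [2 * C]mulrC ler_wpM2l// -[2]mulr1; apply: ler_pM.
- by rewrite divr_ge0// ltW.
- by rewrite divr_ge0// ltW.
- by rewrite ler_pdivrMr.
- by rewrite ler_pdivrMr// mul1r.
Qed.

(** Comparison with the telescoping series of 1/(N+1) - 1/(N+2). *)
Lemma sum_inv_sqr_le N n1 : (1 < n1)%N ->
  \sum_(n < N) ((n + n1)%:R ^+ 2)^-1 <= 1 :> R.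
Proof.
move=> n1_1; apply: (@le_trans _ _ (1 - N.+1%:R^-1)); last first.
  by rewrite gerBl invr_ge0.
elim: N => [|N IH]; first by rewrite big_ord0 invr1 subrr.
rewrite big_ord_recr/=.
have N1 : 0 < N.+1%:R :> R by rewrite ltr0n.
have N2 : 0 < N.+2%:R :> R by rewrite ltr0n.
have h : ((N + n1)%:R ^+ 2)^-1 <= (N.+1%:R * N.+2%:R)^-1 :> R.
  rewrite lef_pV2 ?posrE ?mulr_gt0 ?exprn_gt0 ?ltr0n ?addn_gt0 ?(ltnW n1_1) ?orbT//.
  rewrite expr2; apply: ler_pM => //; rewrite ler_nat.
    by rewrite -[N.+1]addn1 leq_add2l ltnW.
  by rewrite -[N.+2]addn2 leq_add2l.
have -> : 1 - N.+2%:R^-1 = (1 - N.+1%:R^-1) + (N.+1%:R * N.+2%:R)^-1 :> R.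
  have e : N.+2%:R = N.+1%:R + 1 :> R by rewrite -natr1.
  by move: N2; rewrite e => N2; field; rewrite !gt_eqF.
exact: lerD.
Qed.
End asymptotics.

Section upper.
Context d (Omega : measurableType d) (R : realType).
Variables (P : probability Omega R).
Variables (xi tau zeta : nat -> Omega -> measurableTypeR R).
Variables (Pi Lambda : {measure set (measurableTypeR R) -> \bar R}).
Hypothesis prmM : Poisson_random_measure P (supOU_intensity Pi Lambda)
  (point_measure xi tau zeta).

(** The Borel-Cantelli lemma, applied to the events that the process exceeds
    the level C ln n / ln (ln n) on [n, n+1]. *)
Lemma supOU_rate_bounded K : 1 <= K ->
  (moment (-1) Pi < +oo)%E -> (moment 0 Pi < +oo)%E ->
  Levy_measure Lambda -> (\int[Lambda]_(z in `]0%R, 1%R]) z%:E < +oo)%E ->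
  P.-negligible [set w | tame xi zeta K w /\
    ~ exists C t0 : R, forall t, t0 <= t ->
      ((ln (ln t) / ln t)%:E * supOU xi tau zeta t w <= C%:E)%E].
Proof.
move=> K1 Pi1 Pi0 L2 L1.
have K0 : 0 <= K by apply: le_trans K1.
have [r [D D0 [r0 nuE rD]]] := cell_total_bounded K1 Pi1 Pi0 L2 L1.
pose C := 2 * D + 8 * K.
have C0 : 0 <= C by rewrite addr_ge0// mulr_ge0.
(* From n1 on, ln n >= 2: this makes ln (ln n) positive and controls the rate
   on a unit interval. *)
pose n1 := (Num.trunc (expR (2 : R))).+2.
have lnn1 n : (n1 <= n)%N -> 2 <= ln n%:R :> R.
  move=> n1n; rewrite -[2]expRK ler_ln ?posrE ?expR_gt0 ?ltr0n ?(leq_trans _ n1n)//.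
  apply: le_trans (ltW (truncnS_gt _)) _; rewrite ler_nat.
  by apply: leq_trans n1n.
pose level n : R := C * (ln n%:R / ln (ln n%:R)).
pose F n := exceed xi tau zeta K (n + n1)%:R (level (n + n1)%N)%:E.
have mF n : measurable (F n) by exact: (measurable_exceed prmM).
have PF n : (P (F n) <= (((n + n1)%:R ^+ 2)^-1)%:E)%E.
  have lnn := lnn1 _ (leq_addl n n1).
  have h := chernoff_exponent_le K1 D0 (lt_le_trans (ltr1n R 2) lnn) erefl erefl.
  have s0 : 0 <= ln (ln (n + n1)%:R) / (4 * K) :> R.
    by rewrite divr_ge0 ?mulr_ge0// ln_ge0// (le_trans _ lnn)// ler1n.
  apply: le_trans (exceed_prob_le prmM _ K1 s0 r0 (nuE _) rD) _.
  by rewrite lee_fin -expR_lnN2 ?addn_gt0 ?orbT// ler_expR.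
have nullF : P.-negligible (lim_sup_set F).
  apply/negligibleP.
    by apply: bigcap_measurable => // k _; exact: bigcup_measurable.
  apply: lim_sup_set_cvg0 => //; apply: (@le_lt_trans _ _ 1%E); last exact: ltry.
  apply: lime_le; first by apply: is_cvg_nneseries.
  apply: nearW => N; rewrite big_mkord.
  apply: (@le_trans _ _ (\sum_(i < N) (((i + n1)%:R ^+ 2)^-1)%:E)%E).
    by apply: lee_sum => i _; exact: PF.
  by rewrite sumEFin lee_fin sum_inv_sqr_le.
apply: negligibleS nullF => w [tw]; apply: contra_notP.
move=> /existsNP[n0 nF]; exists (2 * C), (n0 + n1)%:R => t tn0.
pose n := Num.trunc t.
have t0 : 0 <= t by apply: le_trans tn0.
have /andP[nt tn] := truncn_itv t0.
have n0n : (n0 + n1 <= n)%N by rewrite truncn_ge_nat.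
have n1n : (n1 <= n)%N by apply: leq_trans n0n; exact: leq_addl.
have tT : n%:R <= t <= n%:R + 1 by rewrite nt/= natr1 ltW.
have [rate0 rateC] :=
  rate_window_le C0 (leq_trans (isT : (1 < n1)%N) n1n) (lnn1 _ n1n) tT.
have X : (supOU xi tau zeta t w <= (level n)%:E)%E.
  rewrite leNgt; apply/negP => /(supOU_gt_cell_sum K1 tw tT)[N0 N0P].
  apply: nF => /=; exists (n - n1)%N => //=; first by rewrite leq_subRL // addnC.
  by rewrite /F subnK//; exists N0 => // N /= ?; exact: N0P.
apply: le_trans (lee_wpmul2l _ X) _; first by rewrite lee_fin.
by rewrite -EFinM lee_fin.
Qed.
End upper.

(** * The lower bound *)

Lemma positive_piece (R : realType)
    (Q : {measure set (measurableTypeR R) -> \bar R})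
    (F : nat -> set (measurableTypeR R)) :
  concentrated_on_pos Q -> (0 < Q [set: R])%E -> (forall i, measurable (F i)) ->
  (forall x : R, 0 < x -> exists i, F i x) -> exists i, (0 < Q (F i))%E.
Proof.
move=> Q0 Qp mF cov; apply/not_existsP => h.
have F0 i : Q.-negligible (F i).
  apply/negligibleP => //; apply/eqP; rewrite eq_le measure_ge0 andbT leNgt.
  by apply/negP; exact: h.
have N0 : Q.-negligible (`]-oo, (0 : R)]%classic : set (measurableTypeR R)).
  by apply/negligibleP => //; exact: measurable_itv.
have : Q.-negligible [set: measurableTypeR R].
  apply: negligibleS (negligibleU N0 (negligible_bigcup F0)) => x _ /=.
  rewrite in_itv/=; have [x0|x0] := leP x 0; first by left.
  by right; have [i Fi] := cov x x0; exists i.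
by move/negligibleP => /(_ measurableT) QT; move: Qp; rewrite QT ltxx.
Qed.

Lemma fact_le_expn m n : (n <= m)%N -> (n`! <= m ^ n)%N.
Proof.
elim: n => [//|n IH] nm; by rewrite factS expnS leq_mul// IH// ltnW.
Qed.

Section asymptotics.
Variable R : realType.

(** Since k! <= k^k, the right-hand side is at least exp(-c) (c k)^k, hence at
    least exp(-c) 2^k. *)
Lemma poisson_weight_block_ge (c : R) k : 0 < c -> (0 < k)%N -> 2 <= c * k%:R ->
  expR (- c) * k%:R <= poisson_weight c k * (k ^ (2 * k))%:R.
Proof.
move=> c0 k0 ck; rewrite /poisson_weight [leRHS]mulrAC [leRHS]mulrC.
rewrite ler_wpM2l ?expR_ge0// natrX mulnC exprM.
have kR : 0 < k%:R :> R by rewrite ltr0n.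
have fk : 0 < k`!%:R :> R by rewrite ltr0n fact_gt0.
have fle : k`!%:R <= k%:R ^+ k :> R.
  by rewrite -natrX ler_nat fact_le_expn.
rewrite mulrAC ler_pdivlMr//.
apply: (@le_trans _ _ (2 ^+ k * k%:R ^+ k)).
  apply: ler_pM => //.
  by rewrite -natrX ler_nat ltnW// ltn_expl.
apply: (@le_trans _ _ ((c * k%:R) ^+ k * k%:R ^+ k)).
  by rewrite ler_wpM2r ?exprn_ge0// lerXn2r ?nnegrE// mulr_ge0// ltW.
by rewrite exprMn -mulrA -exprD addnn -mul2n exprM [(_ ^+ 2) ^+ _]exprAC.
Qed.

(** Such t lies between k^k and k^(3k), so ln t is between k ln k and
    3 k ln k, while ln (ln t) >= ln k. *)
Lemma rate_block_ge (t : R) k : expR 1 <= k%:R :> R ->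
  (k ^ (2 * k))%:R <= t <= (2 * k ^ (2 * k))%:R ->
  0 <= ln (ln t) / ln t /\ 3^-1 <= ln (ln t) / ln t * k%:R.
Proof.
move=> ek /andP[kt tk].
have kR : 0 < k%:R :> R by exact: lt_le_trans (expR_gt0 _) ek.
have k2 : (1 < k)%N.
  rewrite -(ltr_nat R); apply: lt_le_trans ek.
  by rewrite expR_gt1.
have lk : 1 <= ln k%:R :> R by rewrite -[leLHS]expRK ler_ln ?posrE ?expR_gt0.
have t0 : 0 < t.
  by apply: lt_le_trans kt; rewrite ltr0n expn_gt0 ltnW.
have t1 : k%:R * ln k%:R <= ln t.
  rewrite mulrC mulr_natr -lnXn// ler_ln ?posrE ?exprn_gt0//.
  by apply: le_trans kt; rewrite -natrX ler_nat leq_pexp2l ?leq_pmull// ltnW.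
have t2 : ln t <= 3 * (k%:R * ln k%:R).
  rewrite mulrA -natrM mulrC mulr_natr -lnXn// ler_ln ?posrE ?exprn_gt0//.
  apply: le_trans tk _; rewrite -natrX ler_nat (_ : 3 * k = k + 2 * k)%N.
    rewrite expnD leq_mul2r (leq_trans k2) ?orbT//.
    by rewrite -[X in (X <= _)%N]expn1 leq_pexp2l// ltnW.
  by rewrite -[X in (X + _)%N]mul1n -mulnDl.
have T0 : 0 < ln t by apply: lt_le_trans t1; rewrite mulr_gt0// (lt_le_trans ltr01).
have kl : ln k%:R <= ln (ln t).
  rewrite ler_ln ?posrE//; apply: le_trans t1; rewrite ler_peMr// ltW.
split; first by rewrite divr_ge0 ?(ltW T0)// (le_trans _ kl)// (le_trans ler01).
rewrite mulrAC ler_pdivlMr//.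
have : ln k%:R * k%:R <= ln (ln t) * k%:R by rewrite ler_wpM2r// ltW.
by lra.
Qed.
End asymptotics.

Section lower.
Context d (Omega : measurableType d) (R : realType).
Variables (P : probability Omega R).
Variables (xi tau zeta : nat -> Omega -> measurableTypeR R).
Variables (Pi Lambda : {measure set (measurableTypeR R) -> \bar R}).

Local Notation point k w := ((xi k w, tau k w, zeta k w) : state R).
Local Notation M := (point_measure xi tau zeta).

Definition box b j n : set (state R) :=
  `]0, (b.+1%:R : R)]%classic `*` `](n%:R : R), n.+1%:R]%classic `*` band j.

Lemma measurable_box b j n : measurable (box b j n).
Proof.
by apply: measurableX; [exact: measurableX|exact: measurable_band].
Qed.

Lemma box_inj b j n n' (p : state R) : box b j n p -> box b j n' p -> n = n'.
Proof.
move=> [[_ /=]] + _ [[_ /=]] + _; rewrite !in_itv/= => /andP[a1 a2] /andP[b1 b2].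
apply/eqP; rewrite eqn_leq -ltnS -(ltr_nat R) (lt_le_trans a1 b2)/=.
by rewrite -ltnS -(ltr_nat R) (lt_le_trans b1 a2).
Qed.

(** At time n + 1, a point of the box has age at most 1, so each contributes at
    least exp(-(b+1)) / (j+1), and the other points contribute nonnegatively. *)
Lemma supOU_ge_box K b j n w : tame xi zeta K w ->
  ((expR (- b.+1%:R) / j.+1%:R)%:E * M w (box b j n) <=
   supOU xi tau zeta n.+1%:R w)%E.
Proof.
move=> tw; rewrite /supOU /point_measure /= /mseries.
rewrite -nneseriesZl// [leRHS]eseries_mkcond.
apply: lee_nneseries => [k _ _|k _].
  by rewrite mule_ge0// lee_fin divr_ge0 ?expR_ge0.
rewrite /= diracE.
have [x0 z0 _] := tw k.
have [/set_mem|] := boolP (point k w \in box b j n).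
  move=> [[/= xb nt] [_ /andP[_ jz]]].
  move: xb nt; rewrite /= !in_itv/= => /andP[_ xb] /andP[nt tn].
  rewrite tn mule1 lee_fin; apply: ler_pM; rewrite ?expR_ge0 ?invr_ge0//.
    rewrite ler_expR mulNr lerN2 -[leRHS]mulr1.
    apply: ler_pM => //; first exact: ltW.
      by rewrite subr_ge0.
    by move: nt; rewrite -natr1; lra.
  by rewrite -[leLHS]mul1r ler_pdivrMr ?ltr0n// mulrC ltW.
move=> _; rewrite mule0; case: ifPn => // _.
by rewrite lee_fin mulr_ge0 ?expR_ge0// ltW.
Qed.

Hypothesis prmM : Poisson_random_measure P (supOU_intensity Pi Lambda) M.

(** Pi and Lambda are positive, so they charge one of countably many sets that
    cover the half-line and have finite mass. *)
Lemma box_intensity : concentrated_on_pos Pi -> (0 < Pi [set: R])%E ->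
  (moment 0 Pi < +oo)%E ->
  Levy_measure Lambda -> (0 < Lambda [set: R])%E ->
  (\int[Lambda]_(z in `]0%R, 1%R]) z%:E < +oo)%E ->
  exists b j, exists2 c : R, 0 < c &
    forall n, supOU_intensity Pi Lambda (box b j n) = c%:E.
Proof.
move=> Pi0 Pip m0 LL Lap L1.
have [b bp] : exists b, (0 < Pi (`]0%R, (b.+1%:R : R)]%classic))%E.
  apply: (positive_piece Pi0 Pip) => [i|x x0]; first exact: measurable_itv.
  by exists (Num.trunc x); rewrite /= in_itv/= x0 ltW// truncnS_gt.
have [j jp] : exists j, (0 < Lambda (band j))%E.
  apply: (positive_piece (proj1 LL) Lap); first exact: measurable_band.
  exact: band_cover.
have [bL bLoo ubL] := Lambda_band_sum LL L1.
have [|Lfin _] :=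
  @band_sum_bounded_fin _ _ (fun j => j.+1%:R^-1) _ _ bLoo ubL.
  by move=> i; rewrite invr_gt0 ltr0n.
have Pfin : Pi (`]0%R, (b.+1%:R : R)]%classic) \is a fin_num.
  rewrite ge0_fin_numE//; apply: le_lt_trans m0; rewrite /moment.
  under eq_integral do rewrite powRr0.
  rewrite integral_cst// mul1e; apply: le_measure; rewrite ?inE//.
  by move=> x; rewrite /= !in_itv/= => /andP[->].
exists b, j, (fine (Pi (`]0%R, (b.+1%:R : R)]%classic)) * fine (Lambda (band j))).
  by rewrite mulr_gt0// fine_gt0// ?bp ?jp ltey_eq ?Pfin ?Lfin.
move=> n; rewrite supOU_intensity_setX//; last exact: measurable_band.
rewrite lebesgue_measure_itv /= lte_fin ltr_nat ltnSn -EFinD.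
rewrite -[n.+1%:R]natr1 addrAC subrr add0r.
by rewrite mule1 EFinM !fineK.
Qed.

(** The block has k^(2k) members, far more than the inverse of the probability
    that a given count equals k, which is at most of order (k/c)^k; yet the
    logarithms of its indices are still of order k ln k. *)
Definition miss b j k : set Omega :=
  [set w | forall i : 'I_(k ^ (2 * k)),
     M w (box b j (k ^ (2 * k) + i)) <> k%:R%:E].

Lemma miss_prob_le b j (c : R) k : 0 < c ->
  (forall n, supOU_intensity Pi Lambda (box b j n) = c%:E) ->
  (P (miss b j k) <=
   (expR (- (poisson_weight c k * (k ^ (2 * k))%:R)))%:E)%E.
Proof.
move=> c0 nuE; set L := (k ^ (2 * k))%N.
rewrite /miss (@counts_independent _ _ _ _ _ P _ M prmM _
  (fun i : 'I_L => box b j (L + i)) (fun=> ~` [set k%:R%:E])).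
- under eq_bigr => i _.
    rewrite -[X in P X]/(~` [set w | M w (box b j (L + i)) = k%:R%:E]).
    rewrite probability_setC; last first.
      by apply: (measurable_count prmM); exact: measurable_box.
    rewrite (count_prob prmM _ _ (ltW c0))//; last exact: measurable_box.
    rewrite -EFinB; over.
  rewrite -[X in (X <= _)%E]/(\prod_(i < L) (1 - poisson_weight c k)%:E)%E.
  rewrite prodEFin lee_fin prodr_const card_ord.
  have p1 : 0 <= 1 - poisson_weight c k.
    rewrite subr_ge0 -lee_fin -(count_prob prmM k (measurable_box b j 0) (ltW c0))//.
    by apply: probability_le1; apply: (measurable_count prmM); exact: measurable_box.
  rewrite -[in leRHS]mulNr expRM_natr lerXn2r ?nnegrE ?expR_ge0//.
  exact: expR_ge1Dx.
- by move=> i; exact: measurable_box.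
- by move=> i i' _ _ [p [/= h h']]; apply/val_inj/(addnI (box_inj h h')).
- by move=> i; apply: measurableC; exact: emeasurable_set1.
Qed.

(** The events [miss] have probabilities tending to 0, so the intersection of
    all of them from some rank on is null. *)
Lemma negligible_rarely b j (c : R) : 0 < c ->
  (forall n, supOU_intensity Pi Lambda (box b j n) = c%:E) ->
  P.-negligible [set w | ~ forall m, exists2 k, (m <= k)%N & ~ miss b j k w].
Proof.
move=> c0 nuE.
pose H m := \bigcap_(k in [set k | (m <= k)%N]) miss b j k.
have mmiss k : measurable (miss b j k).
  rewrite (_ : miss b j k = \bigcap_(i in [set: 'I_(k ^ (2 * k))])
      ~` [set w | M w (box b j (k ^ (2 * k) + i)) = k%:R%:E]); last first.
    by apply/seteqP; split => w /= h; [move=> i _|move=> i]; exact: h.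
  apply: fin_bigcap_measurable; first exact: finite_finset.
  move=> i _; apply: measurableC; apply: (measurable_count prmM).
  exact: measurable_box.
have mH m : measurable (H m).
  by apply: bigcap_measurable => [|k _]; [exists m => /=|exact: mmiss].
suff nullH m : P.-negligible (H m).
  apply: negligibleS (negligible_bigcup nullH) => w /= /existsNP[m hm].
  by exists m => // k /= mk; apply: contrapT => nk; apply: hm; exists k.
apply/negligibleP => //; apply/eqP; rewrite eq_le measure_ge0 andbT leNgt.
apply/negP => Hp.
have Hfin : P (H m) \is a fin_num by exact: fin_num_measure.
set p := fine (P (H m)); have p0 : 0 < p.
  by rewrite fine_gt0// Hp ltey_eq Hfin.
pose a := expR (- c); have a0 : 0 < a by exact: expR_gt0.
(* Large enough for k >= m, c k >= 2 and p a k > 1, where the last one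
   contradicts p <= exp(- a k) <= 1 / (1 + a k). *)
pose k := (m + (Num.trunc (2 / c)).+1 + (Num.trunc (p * a)^-1).+1)%N.
have k2 : 2 <= c * k%:R.
  rewrite mulrC -ler_pdivrMr//; apply: le_trans (ltW (truncnS_gt _)) _.
  by rewrite ler_nat /k -addnA addnCA leq_addr.
have kp : (p * a)^-1 < k%:R.
  by apply: lt_le_trans (truncnS_gt _) _; rewrite ler_nat leq_addl.
have k0 : (0 < k)%N by rewrite /k addnS.
have : p <= expR (- (a * k%:R)).
  rewrite -lee_fin fineK//; apply: (@le_trans _ _ (P (miss b j k))).
    apply: le_measure; rewrite ?inE//; apply: bigcap_inf => /=.
    by rewrite /k -addnA leq_addr.
  apply: le_trans (miss_prob_le k c0 nuE) _.
  by rewrite lee_fin ler_expR lerN2 poisson_weight_block_ge.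
apply/negP; rewrite -ltNge expRN -[ltRHS]invrK ltf_pV2 ?posrE ?expR_gt0 ?invr_gt0//.
apply: lt_le_trans (expR_ge1Dx _); rewrite ltr_wpDl//.
by move: kp; rewrite invfM mulrC ltr_pdivrMl.
Qed.

Lemma supOU_rate_often K b j w : tame xi zeta K w ->
  (forall m, exists2 k, (m <= k)%N & ~ miss b j k w) ->
  forall t0 : R, exists2 t : R, t0 < t &
    ((expR (- b.+1%:R) / j.+1%:R / 3)%:E <=
     (ln (ln t) / ln t)%:E * supOU xi tau zeta t w)%E.
Proof.
move=> tw often t0.
have [k] := often (maxn (Num.trunc (expR (1 : R))).+1 (Num.trunc t0).+1).
rewrite geq_max => /andP[k1 kt0] /existsNP[i /contrapT Mi].
set n := (k ^ (2 * k) + i)%N in Mi.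
have ek : expR 1 <= k%:R :> R.
  by apply: le_trans (ltW (truncnS_gt _)) _; rewrite ler_nat.
have k0 : (0 < k)%N by exact: leq_ltn_trans k1.
have kn : (k ^ (2 * k) <= n.+1 <= 2 * k ^ (2 * k))%N.
  by rewrite leqW ?leq_addr//= mul2n -addnn ltn_add2l ltn_ord.
have [rate0 ratek] : 0 <= ln (ln n.+1%:R) / ln n.+1%:R :> R /\
    3^-1 <= ln (ln n.+1%:R) / ln n.+1%:R * k%:R :> R.
  by apply: rate_block_ge => //; rewrite !ler_nat.
exists n.+1%:R.
  apply: lt_le_trans (truncnS_gt _) _; rewrite ler_nat (leq_trans kt0)//.
  apply: leq_trans (andP kn).1; rewrite -[X in (X <= _)%N]expn1.
  by rewrite leq_pexp2l// muln_gt0.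
apply: le_trans (lee_wpmul2l _ (supOU_ge_box b j n tw)); last by rewrite lee_fin.
rewrite Mi -!EFinM lee_fin mulrCA ler_wpM2l// divr_ge0//; exact: expR_ge0.
Qed.
End lower.

(** * The limit superior *)

Lemma limf_esup_pinfty_bounds (R : realType) (f : R -> \bar R) (a b : R) :
  (exists t0 : R, forall t, t0 <= t -> (f t <= b%:E)%E) ->
  (forall t0 : R, exists2 t, t0 < t & (a%:E <= f t)%E) ->
  (a%:E <= limf_esup f (pinfty_nbhs R) <= b%:E)%E.
Proof.
move=> [t0 fb] fa; rewrite limf_esupE; apply/andP; split.
  apply: le_ereal_inf_tmp => _ [V [m [_ mV]] <-].
  have [t mt aft] := fa m; apply: le_trans aft _; apply: ereal_sup_ubound.
  by exists t => //; exact: mV.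
apply: (@le_trans _ _ (ereal_sup [set f t | t in `]t0, +oo[%classic])).
  apply: ereal_inf_lbound; exists `]t0, +oo[%classic => //.
  by exists t0; split; [exact: num_real|move=> x; rewrite /= in_itv/= andbT].
apply: ge_ereal_sup => _ [t + <-]; rewrite /= in_itv/= andbT => /ltW; exact: fb.
Qed.

Theorem theorem2 (R : realType) (d : measure_display) (Omega : measurableType d)
    (P : probability Omega R)
    (Pi Lambda : {measure set (measurableTypeR R) -> \bar R})
    (xi tau zeta : nat -> {RV P >-> measurableTypeR R}) :
  concentrated_on_pos Pi ->
  (0 < Pi [set: R])%E ->
  (moment (-1) Pi < +oo)%E ->
  Levy_measure Lambda ->
  (0 < Lambda [set: R])%E ->
  (\int[Lambda]_(z in `]1%R, +oo[) (ln z)%:E < +oo)%E ->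
  Poisson_random_measure P (supOU_intensity Pi Lambda)
    (point_measure xi tau zeta) ->
  (\int[Lambda]_(z in `]0%R, 1%R]) z%:E < +oo)%E ->
  (moment 0 Pi < +oo)%E ->
  (ereal_inf [set y%:E | y in [set y : R | (0 < y)%R /\ tail Lambda y = 0%E]]
     < +oo)%E ->
  {ae P, forall w,
    (0 < limf_esup (fun t : R => (ln (ln t) / ln t)%:E * supOU xi tau zeta t w)
           (pinfty_nbhs R) < +oo)%E}.
Proof.
move=> Pi0 Pip Pi1 LL Lap _ prmM L1 m0 /ereal_inf_lt[_ [y [y0 tail_y] <-] _].
pose K := Num.max 1 y.
have K1 : 1 <= K by rewrite le_max lexx.
have tailK : tail Lambda K = 0%E.
  apply/eqP; rewrite eq_le measure_ge0 andbT -tail_y.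
  apply: le_measure; rewrite ?inE//.
  move=> z; rewrite /= !in_itv/= !andbT; apply: le_lt_trans.
  by rewrite le_max lexx orbT.
have [b [j [c c0 nuE]]] := box_intensity Pi0 Pip m0 LL Lap L1.
have nT := negligible_not_tame prmM Pi0 (proj1 LL) tailK.
have nU := supOU_rate_bounded prmM K1 Pi1 m0 LL L1.
have nL := negligible_rarely prmM c0 nuE.
apply: negligibleS (negligibleU nT (negligibleU nU nL)) => w /= h.
apply: contrapT => /not_orP[/contrapT tw /not_orP[]].
move=> /not_andP[//|/contrapT[C [t0 ub]]] /contrapT often.
apply: h; have /andP[lo hi] := limf_esup_pinfty_bounds
  (ex_intro _ t0 ub) (supOU_rate_often tw often).
by rewrite (lt_le_trans _ lo) ?(le_lt_trans hi) ?ltry// lte_fin.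
Qed.
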